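(* Let $M=(a_{ijk},b_{ij})$ be an $s$-stage diagonally-implicit IMEX MR-NPRK method with $\mathcal{S}^{\{1\}}\cup\mathcal{S}^{\{2\}}=\mathcal{S}$ and $s^{\{1\}}<s^{\{2\}}$. Suppose that (i) $M$ is fully-decoupled or $1\to 2$ coupled; (ii) $M$ is stiffly accurate; (iii) the reduced first underlying method $\widehat{M}^{\{1\}}$ is a diagonally-implicit Runge--Kutta (DIRK) method with non-zero diagonal coefficients. Then $M$ is L-stable in the stiff $z_1$ limit, i.e. for every fixed $z_2\in\mathbb{C}$, $$\lim_{|z_1|\to\infty} R(z_1,z_2)=0,$$ where $R$ is the linear stability function of $M$.
   Context: **NPRK methods.** An $s$-stage nonlinearly partitioned Runge--Kutta (NPRK) method with real coefficients $M=(a_{ijk},b_{ij})$, $i,j,k\in\mathcal{S}:=\{1,\dots,s\}$, applied to $\dot y=F(y,y)$ with step size $h$, is $$Y_i=y_n+h\sum_{j=1}^s\sum_{k=1}^s a_{ijk}F(Y_j,Y_k)\ (i=1,\dots,s),\qquad y_{n+1}=y_n+h\sum_{i=1}^s\sum_{j=1}^s b_{ij}F(Y_i,Y_j).$$ **Underlying methods.** The (unreduced) underlying Runge--Kutta methods $M^{\{1\}},M^{\{2\}}$ are the classical $s$-stage Runge--Kutta methods with coefficients $$a^{\{1\}}_{ij}=\sum_{k}a_{ijk},\quad b^{\{1\}}_i=\sum_j b_{ij};\qquad a^{\{2\}}_{ik}=\sum_j a_{ijk},\quad b^{\{2\}}_j=\sum_i b_{ij}.$$ Write $\mathbf{A}^{\{r\}}=[a^{\{r\}}_{ij}]$,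 $\mathbf{b}^{\{r\}}=[b^{\{r\}}_i]$. **Reducibility.** A Runge--Kutta method is irreducible if it has no equivalent stages and no set of stages can be removed without altering the output of the method (a set $T$ of stages is removable if neither the output nor any stage outside $T$ uses the stages of $T$, i.e. $b_j=0$ and $a_{ij}=0$ for $j\in T$, $i\notin T$). $\widehat{M}^{\{r\}}$ denotes the reduced (irreducible) tableau obtained from $M^{\{r\}}$. The irreducible stage index set is $\mathcal{S}^{\{r\}}:=\{\nu\in\mathcal{S}: Y_\nu \text{ is an irreducible stage of } M^{\{r\}}\}$, i.e. the indices of the stages retained in $\widehat{M}^{\{r\}}$, and $s^{\{r\}}:=|\mathcal{S}^{\{r\}}|$. A multirate NPRK (MR-NPRK) method is an NPRK method with $s^{\{1\}}\ne s^{\{2\}}$. **Coupling types.** An MR-NPRK method is - *fully-decoupled* if $\mathcal{S}^{\{1\}}\cap\mathcal{S}^{\{2\}}=\emptyset$, $b_{ij}\neq 0$ only if $i\in\mathcal{S}^{\{1\}},j\in\mathcal{S}^{\{2\}}$, and $a_{ijk}\ne0$ only if $j\in\mathcal{S}^{\{1\}},k\in\mathcal{S}^{\{2\}}$ ($i\in\mathcal{S}$ arbitrary); - *$1\to2$ coupled* if the same holds except that $a_{ijk}$ may also be non-zero for $i,j,k\in\mathcal{S}^{\{1\}}$ (with at least one such coefficient non-zero). **Diagonally-implicit IMEX.** The method treats the first argument diagonally implicitly and the second explicitly: $a_{ijk}=0$ whenever $j>i$ or $k\ge i$. **Stiffly accurate.** $y_{n+1}=Y_s$, i.e. $b_{jk}=a_{sjk}$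 for all $j,k$. **Stability function.** Applied to $y'=\lambda_1u+\lambda_2v$ with $u=v=y$ (i.e. $F(u,v)=\lambda_1u+\lambda_2v$), the method gives $y_{n+1}=R(z_1,z_2)y_n$, $z_i=h\lambda_i$, with $$R(z_1,z_2)=\frac{\det\left(\mathbf{I}-(z_1\mathbf{A}^{\{1\}}+z_2\mathbf{A}^{\{2\}})+\mathbf{e}(z_1\mathbf{b}^{\{1\}}+z_2\mathbf{b}^{\{2\}})^{T}\right)}{\det\left(\mathbf{I}-z_1\mathbf{A}^{\{1\}}-z_2\mathbf{A}^{\{2\}}\right)},$$ where $\mathbf{e}=(1,\dots,1)^T\in\mathbb{R}^s$. *)

(* Defs.v *)
From HB Require Import structures.
From mathcomp Require Import all_boot all_order all_algebra.
From mathcomp Require Import complex.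
From mathcomp Require Import all_classical all_reals all_analysis.

Set Implicit Arguments.
Unset Strict Implicit.
Unset Printing Implicit Defensive.

Import Order.TTheory GRing.Theory Num.Theory.
Import numFieldNormedType.Exports.

Local Open Scope classical_set_scope.
Local Open Scope complex_scope.
Local Open Scope ring_scope.

(** * Runge-Kutta tableaux and their reduction *)

Record rk (R : Type) (s : nat) := RK {
  rkA : 'M[R]_s;
  rkb : 'rV[R]_s
}.

Section Reduction.
Context {R : realType}.

(* The set [T] of stages is used neither by the output nor by a stage outside
   [T]. *)
Definition removable {s} (m : rk R s) (T : {set 'I_s}) : Prop :=
  (forall j, j \in T -> rkb m 0 j = 0) /\
  (forall i j, i \notin T -> j \in T -> rkA m i j = 0).

(* A partition of the stages, presented by a map [rep] sending each stage to a
   chosen representative of its class, such that two stages of the same class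
   have the same total weight on every class.  The stages of a class then solve
   the same equation, hence compute the same value; this is the notion of
   Hundsdorfer-Spijker (S-reducibility) and Butcher (P-reducibility). *)
Definition equivalent_classes {s} (m : rk R s) (rep : 'I_s -> 'I_s) : Prop :=
  (forall i, rep (rep i) = rep i) /\
  (forall i i' l, rep i = rep i' ->
     \sum_(k | rep k == l) rkA m i k = \sum_(k | rep k == l) rkA m i' k).

Definition equivalent_stages {s} (m : rk R s) (i j : 'I_s) : Prop :=
  exists2 rep, equivalent_classes m rep & rep i = rep j.

Definition irreducible_rk {s} (m : rk R s) : Prop :=
  (forall i j, equivalent_stages m i j -> i = j) /\
  (forall T : {set 'I_s}, removable m T -> T = finset.set0).

(* Every use of a stage is redirected to its representative.  The stages that
   are not representatives stay in the tableau, with a zero column. *)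
Definition merge_stages {s} (m : rk R s) (rep : 'I_s -> 'I_s) : rk R s :=
  RK (\matrix_(i, j) \sum_(k | rep k == j) rkA m i k)
     (\row_j \sum_(k | rep k == j) rkb m 0 k).

(* [enum_val] lists the elements of [S] in increasing order, so the retained
   stages keep their relative order. *)
Definition retain_stages {s} (m : rk R s) (S : {set 'I_s}) : rk R #|S| :=
  RK (\matrix_(i, j) rkA m (enum_val i) (enum_val j))
     (\row_j rkb m 0 (enum_val j)).

(* [mhat] is a reduced tableau of [m] and [S] is the index set of the stages of
   [m] retained in it.  This is a relation because any stage of a class of
   equivalent stages may be retained.  Merging first loses no generality: a
   partition of the stages left after a removal extends by singletons. *)
Definition reduction {s} (m : rk R s) (S : {set 'I_s}) (mhat : rk R #|S|) :
    Prop :=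
  exists rep,
    [/\ equivalent_classes m rep,
        removable (merge_stages m rep) (finset.setC S),
        mhat = retain_stages (merge_stages m rep) S
      & irreducible_rk mhat].

Definition dirk {s} (m : rk R s) : Prop :=
  forall i j : 'I_s, (i < j)%N -> rkA m i j = 0.

Definition nonzero_diagonal {s} (m : rk R s) : Prop :=
  forall i : 'I_s, rkA m i i != 0.

End Reduction.

(** * Nonlinearly partitioned Runge-Kutta methods *)

(* [stagec M i j k] is a_ijk and [outc M i j] is b_ij; stages are numbered from
   0. *)
Record nprk (R : Type) (s : nat) := NPRK {
  stagec : 'I_s -> 'I_s -> 'I_s -> R;
  outc : 'I_s -> 'I_s -> R
}.

Section Nprk.
Context {R : realType} {s : nat}.
Implicit Types (M : nprk R s).

Definition underlying1 M : rk R s :=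
  RK (\matrix_(i, j) \sum_(k < s) stagec M i j k)
     (\row_i \sum_(j < s) outc M i j).

Definition underlying2 M : rk R s :=
  RK (\matrix_(i, k) \sum_(j < s) stagec M i j k)
     (\row_j \sum_(i < s) outc M i j).

Definition multirate (S1 S2 : {set 'I_s}) : Prop := #|S1| != #|S2|.

Definition fully_decoupled M (S1 S2 : {set 'I_s}) : Prop :=
  [/\ finset.setI S1 S2 = finset.set0,
      (forall i j, outc M i j != 0 -> i \in S1 /\ j \in S2)
    & (forall i j k, stagec M i j k != 0 -> j \in S1 /\ k \in S2)].

Definition coupled12 M (S1 S2 : {set 'I_s}) : Prop :=
  [/\ finset.setI S1 S2 = finset.set0,
      (forall i j, outc M i j != 0 -> i \in S1 /\ j \in S2),
      (forall i j k, stagec M i j k != 0 ->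
         (j \in S1 /\ k \in S2) \/ [/\ i \in S1, j \in S1 & k \in S1])
    & (exists i j k,
         [/\ i \in S1, j \in S1, k \in S1 & stagec M i j k != 0])].

Definition di_imex M : Prop :=
  forall i j k : 'I_s, (i < j)%N || (i <= k)%N -> stagec M i j k = 0.

(* The last stage is the index [i] with [i.+1 = s]. *)
Definition stiffly_accurate M : Prop :=
  forall i : 'I_s, i.+1 = s -> forall j k, outc M j k = stagec M i j k.

(** * Linear stability *)

Definition stabA M (z1 z2 : R[i]) : 'M[R[i]]_s :=
  z1 *: map_mx (real_complex R) (rkA (underlying1 M)) +
  z2 *: map_mx (real_complex R) (rkA (underlying2 M)).

Definition stabb M (z1 z2 : R[i]) : 'rV[R[i]]_s :=
  z1 *: map_mx (real_complex R) (rkb (underlying1 M)) +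
  z2 *: map_mx (real_complex R) (rkb (underlying2 M)).

Definition stab_num M (z1 z2 : R[i]) : R[i] :=
  \det (1%:M - stabA M z1 z2 + (const_mx 1 : 'cV_s) *m stabb M z1 z2).

Definition stab_den M (z1 z2 : R[i]) : R[i] := \det (1%:M - stabA M z1 z2).

Definition stability_function M (z1 z2 : R[i]) : R[i] :=
  stab_num M z1 z2 / stab_den M z1 z2.

End Nprk.

(* The neighbourhoods of infinity in C, i.e. the filter |z| -> oo. *)
Definition cinfty (R : realType) : set_system R[i] :=
  [set P | \forall r \near +oo, forall z : R[i], r%:C < `|z| -> P z].
Arguments cinfty : clear implicits.

(* As x / 0 = 0, the limit alone would not say that the stability function is
   defined near infinity; the first conjunct does.  [R[i]^o] carries the
   topology of the complex modulus. *)
Definition L_stable_stiff_limit (R : realType) (s : nat) (M : nprk R s) : Prop :=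
  forall z2 : R[i],
    (\forall z1 \near cinfty R, stab_den M z1 z2 != 0) /\
    (stability_function M z1 z2 : R[i]^o) @[z1 --> cinfty R] --> (0 : R[i]^o).

(* Main.v *)
Require Import Defs.
From mathcomp Require Import all_boot all_order all_algebra.
From mathcomp Require Import reals.
From mathcomp Require Import complex boolp classical_sets filter topology normedtype.
From mathcomp Require Import ring.

(** As only columns of stages in S1 carry z1, the denominator is
    [\prod_(i in S1) (1 - z1 a_ii)] with nonzero a_ii, and every other column of
    the matrix in the numerator is free of z1.  The last stage is in S1, because
    an explicit stiffly accurate method never uses it, so it cannot survive in
    the reduced second method.  Stiff accuracy turns the last row of the
    numerator into a unit vector, which costs one degree in z1. *)

Import Order.TTheory GRing.Theory Num.Theory.
Import numFieldNormedType.Exports.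

(** * Which stages a reduced tableau can retain *)

Section Tableaux.
Local Open Scope ring_scope.

(** A stage with zero weight and zero column forms by itself a removable set. *)
Lemma irreducible_stage_used (R : realType) (s : nat) (m : rk R s) (j : 'I_s) :
  irreducible_rk m -> rkb m ord0 j = 0 -> ~ (forall i, rkA m i j = 0).
Proof.
move=> [_ irr] bj Aj.
have /setP/(_ j) : [set j]%SET = finset.set0.
  by apply: irr; split=> [k|i k _]; rewrite inE => /eqP ->.
by rewrite !inE eqxx.
Qed.

(** After merging, the weight and the column of a non-representative are empty sums, so an
    irreducible tableau cannot contain it. *)
Lemma retained_representative (R : realType) (s : nat) (m : rk R s)
    (S : {set 'I_s}) (rep : 'I_s -> 'I_s) (i : 'I_s) :
  (forall k, rep (rep k) = rep k) ->
  irreducible_rk (retain_stages (merge_stages m rep) S) ->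
  i \in S -> rep i = i.
Proof.
move=> rep_idem irr iS; apply/eqP/negPn/negP => rep_i.
have fiber0 (k : 'I_s) : (rep k == i) = false.
  by apply/negbTE/negP => /eqP ki; rewrite -ki rep_idem eqxx in rep_i.
by apply: (irreducible_stage_used _ _ _ (enum_rank_in iS i) irr) => [|k];
  rewrite !mxE enum_rankK_in // big_pred0.
Qed.

(** Retained stages are their own representatives, so the other members of their classes lie outside
    [S] and contribute zero terms: merging changes no retained entry. Hypotheses on [mhat] can thus
    be read on [m] itself. *)
Lemma reduction_supported (R : realType) (s : nat) (m : rk R s)
    (S : {set 'I_s}) (mhat : rk R #|S|) :
  reduction m mhat ->
  (forall k, k \notin S -> rkb m ord0 k = 0) ->
  (forall i k, i \in S -> k \notin S -> rkA m i k = 0) ->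
  mhat = retain_stages m S.
Proof.
move=> [rep [[rep_idem _] _ -> irr]] b0 A0.
have fixS k : k \in S -> rep k = k by exact: retained_representative irr.
have collapse (F : 'I_s -> R) (j : 'I_s) : j \in S ->
    (forall k, k \notin S -> F k = 0) -> \sum_(k | rep k == j) F k = F j.
  move=> jS F0; rewrite (bigD1 j) /=; last by rewrite fixS.
  rewrite big1 ?addr0 // => k /andP[/eqP kj kNj]; apply: F0.
  by apply/negP => /fixS krep; rewrite -kj krep eqxx in kNj.
congr RK; apply/matrixP => i j; rewrite !mxE collapse ?enum_valP //.
  by move=> k; apply: A0; exact: enum_valP.
Qed.

End Tableaux.

(** * Limits of determinants and Moebius functions at infinity *)

Section Limits.
Local Open Scope classical_set_scope.
Local Open Scope complex_scope.
Local Open Scope ring_scope.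

Lemma cvg_det (K : numFieldType) (n : nat) (T : Type) (F : set_system T)
    (A : T -> 'M[K]_n) (L : 'M[K]_n) : Filter F ->
  (forall i j, (A t i j : K^o) @[t --> F] --> (L i j : K^o)) ->
  (\det (A t) : K^o) @[t --> F] --> (\det L : K^o).
Proof.
move=> FF AL; rewrite /determinant.
apply: cvg_big => [|p _]; first exact: add_continuous.
apply: cvgM; first exact: cvg_cst.
by apply: cvg_big => [|i _]; [exact: mul_continuous | exact: AL].
Qed.

Section AtInfinity.
Context {R : realType}.
Implicit Types z a b c : R[i].

Global Instance cinfty_filter : Filter (cinfty R).
Proof.
rewrite /cinfty; split=> [|P Q Pinf Qinf|P Q PQ Pinf] /=.
- by apply: (@nearW _ (pinfty_nbhs R)).
- apply: (@filterS2 _ (pinfty_nbhs R) _ _ _ _ _ Pinf Qinf) => r Pr Qr z rz.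
  by split; [exact: Pr | exact: Qr].
- by apply: (@filterS _ (pinfty_nbhs R) _ _ _ _ Pinf) => r Pr z rz; apply: PQ; exact: Pr.
Qed.

Lemma cinfty_norm_gt (r : R) : \forall z \near cinfty R, r%:C < `|z|.
Proof.
by exists r; split=> [|t rt z]; [exact: num_real | apply: lt_trans; rewrite ltcR].
Qed.

Lemma cinfty_neq a : \forall z \near cinfty R, z != a.
Proof.
(* The modulus is an element of [R[i]]; its real part is the real bound that [cinfty] asks for. *)
have [r ar] : exists r : R, `|a| = r%:C by exists (complex.Re `|a|); rewrite RRe_real ?normr_real.
apply: filterS (cinfty_norm_gt r) => z; rewrite -ar.
by apply: contraTneq => ->; rewrite ltxx.
Qed.

Lemma cvg_inv_cinfty : (z^-1 : R[i]^o) @[z --> cinfty R] --> (0 : R[i]^o).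
Proof.
apply/cvgr0Pnorm_lt => e e0.
have [r er] : exists r : R, e^-1 = r%:C.
  by exists (complex.Re e^-1); rewrite RRe_real ?realV ?gtr0_real.
have := cinfty_norm_gt r; apply: filterS => z; rewrite -er => rz.
by rewrite normfV invf_plt ?posrE // (lt_trans _ rz) // invr_gt0.
Qed.

Lemma cvg_moebius a b c : a != 0 ->
  ((b + z * c) / (1 - z * a) : R[i]^o) @[z --> cinfty R] --> (- (c / a) : R[i]^o).
Proof.
move=> a0.
(* This is (z^-1 b + c) / (z^-1 - a) with z^-1 replaced by its limit 0. *)
have -> : - (c / a) = (0 * b + c) / (0 - a) :> R[i].
  by rewrite mul0r !add0r invrN mulrN.
apply: (@cvg_trans _ ((((z^-1 * b + c) / (z^-1 - a)) : R[i]^o) @[z --> cinfty R])).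
  apply: near_eq_cvg; apply: filterS (cinfty_neq 0) => z z0.
  have -> : b + z * c = z * (z^-1 * b + c) by rewrite mulrDr mulVKf.
  have -> : 1 - z * a = z * (z^-1 - a) by rewrite mulrBr mulfV.
  by rewrite -mulf_div mulfV // mul1r.
have cvgD_inv (u v : R[i]) :
    (z^-1 * u + v : R[i]^o) @[z --> cinfty R] --> (0 * u + v : R[i]^o).
  exact: (cvgD (cvgM cvg_inv_cinfty (cvg_cst _)) (cvg_cst _)).
apply: (cvgM (cvgD_inv _ _) (cvgV _ _)); first by rewrite sub0r oppr_eq0.
exact: (cvgB cvg_inv_cinfty (cvg_cst _)).
Qed.

(** The value a = 0 is included because every stage outside [S1] gives such a factor of the
    denominator. *)
Lemma near_affine_neq0 a : \forall z \near cinfty R, 1 - z * a != 0.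
Proof.
have [->|a0] := eqVneq a 0; first by apply: nearW => z; rewrite mulr0 subr0 oner_eq0.
apply: filterS (cinfty_neq a^-1) => z; apply: contra => /eqP/subr0_eq za.
by rewrite -[z](mulfK a0) -za mul1r.
Qed.

(** The factor (1 - z a_j)^-1 is absorbed into column [j]. Each entry then has a finite limit, being
    a Moebius function of z if a_j is nonzero and constant otherwise. *)
Lemma cvg_det_quotient (n : nat) (C0 C1 : 'M[R[i]]_n) (a : 'I_n -> R[i])
    (p : 'I_n) :
  (forall i j, a j = 0 -> C1 i j = 0) ->
  (forall j, C1 p j = 0) ->
  (forall j, a j = 0 -> C0 p j = 0) ->
  (\det (C0 + z *: C1) / \prod_j (1 - z * a j) : R[i]^o)
    @[z --> cinfty R] --> (0 : R[i]^o).
Proof.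
move=> C1a C1p C0p.
(* The limit of the matrix whose column [j] is divided by [1 - z a_j]; its row
   [p] vanishes. *)
pose L := \matrix_(i, j) (if a j == 0 then C0 i j else - (C1 i j / a j)).
have <- : \det L = 0.
  rewrite (expand_det_row _ p) big1 // => j _; rewrite mxE.
  by case: eqP => [/C0p ->|_]; rewrite ?C1p ?mul0r ?oppr0 ?mul0r.
pose A z : 'M[R[i]]_n := (C0 + z *: C1) *m diag_mx (\row_j (1 - z * a j)^-1).
apply: (@cvg_trans _ ((\det (A z) : R[i]^o) @[z --> cinfty R])).
  apply: near_eq_cvg; apply: nearW => z.
  rewrite det_mulmx det_diag -prodfV; congr (_ * _).
  by apply: eq_bigr => j _; rewrite mxE.
apply: cvg_det => i j; rewrite [L i j]mxE.
under eq_cvg do rewrite /A mul_mx_diag !mxE.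
case: eqVneq => [aj0|]; last exact: cvg_moebius.
apply: cvg_near_cst; apply: nearW => z.
by rewrite aj0 C1a // !mulr0 subr0 addr0 divr1.
Qed.

End AtInfinity.
End Limits.

(** * Structure of the numerator and denominator of the stability function *)

Section StabilityMatrices.
Context {R : realType} {s : nat}.
Implicit Types M : nprk R s.
Local Open Scope complex_scope.
Local Open Scope ring_scope.

(** The part I + z2 (e b2^T - A2) of the numerator matrix that is free of z1; [stab_slope] is its
    coefficient of z1. *)
Definition stab_const_term M (z2 : R[i]) : 'M[R[i]]_s :=
  \matrix_(i, j) ((i == j)%:R +
    z2 * (rkb (underlying2 M) ord0 j - rkA (underlying2 M) i j)%:C).

Definition stab_slope M : 'M[R[i]]_s :=
  \matrix_(i, j) (rkb (underlying1 M) ord0 j - rkA (underlying1 M) i j)%:C.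

End StabilityMatrices.

Section Coefficients.
Context {R : realType} {s : nat} {M : nprk R s}.
Implicit Types (S : {set 'I_s}) (i j p : 'I_s).
Local Open Scope complex_scope.
Local Open Scope ring_scope.

(** A common weakening of both coupling types: the extra coefficients of the coupled case occur only
    in rows of [S1]. *)
Lemma coupling_support S1 S2 : fully_decoupled M S1 S2 \/ coupled12 M S1 S2 ->
  [/\ forall i, i \in S2 -> i \notin S1,
      forall i j, outc M i j != 0 -> i \in S1 /\ j \in S2
    & forall i j k, stagec M i j k != 0 ->
        j \in S1 /\ (k \in S2 \/ i \in S1)].
Proof.
have disjN : finset.setI S1 S2 = finset.set0 ->
    forall i, i \in S2 -> i \notin S1.
  move=> /setP disj i iS2; apply/negP => iS1.
  by have := disj i; rewrite !inE iS1 iS2.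
case=> [[/disjN disj o a]|[/disjN disj o a _]]; split=> // i j k /a.
  by case=> *; split=> //; left.
by case=> -[] *; split=> //; [left | right].
Qed.

Lemma underlying1_support S1 S2 :
  fully_decoupled M S1 S2 \/ coupled12 M S1 S2 ->
  forall j, j \notin S1 -> rkb (underlying1 M) ord0 j = 0 /\
    (forall i, rkA (underlying1 M) i j = 0).
Proof.
move=> /coupling_support[_ out12 stage12] j /negP jS1.
split=> [|i]; rewrite mxE big1 // => l _; apply/eqP/negPn/negP.
  by case/out12.
by case/stage12.
Qed.

(** Rows of [S1] are left out, since coupling may put entries of the second method in columns of
    [S1] there. *)
Lemma underlying2_support S1 S2 :
  fully_decoupled M S1 S2 \/ coupled12 M S1 S2 ->
  forall j, j \notin S2 -> rkb (underlying2 M) ord0 j = 0 /\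
    (forall i, i \in S2 -> rkA (underlying2 M) i j = 0).
Proof.
move=> /coupling_support[disj out12 stage12] j /negP jS2.
split=> [|i /disj/negP iS1]; rewrite mxE big1 // => l _; apply/eqP/negPn/negP.
  by case/out12.
by case/stage12=> _ [].
Qed.

Lemma di_imex_underlying1 i j : di_imex M -> (i < j)%N ->
  rkA (underlying1 M) i j = 0.
Proof. by move=> imex ij; rewrite mxE big1 // => l _; rewrite imex ?ij. Qed.

Lemma di_imex_underlying2 i j : di_imex M -> (i <= j)%N ->
  rkA (underlying2 M) i j = 0.
Proof.
by move=> imex ij; rewrite mxE big1 // => l _; rewrite imex ?ij ?orbT.
Qed.

Lemma stiffly_accurate_underlying p : stiffly_accurate M -> p.+1 = s ->
  (forall j, rkb (underlying1 M) ord0 j = rkA (underlying1 M) p j) /\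
  (forall j, rkb (underlying2 M) ord0 j = rkA (underlying2 M) p j).
Proof.
by move=> stiff ps; split=> j; rewrite !mxE; apply: eq_bigr => l _; exact: stiff.
Qed.

(** A1 is lower triangular and A2 strictly so: the determinant is the product of the diagonal, where
    z2 does not appear. *)
Lemma stab_den_di_imex (z1 z2 : R[i]) : di_imex M ->
  stab_den M z1 z2 = \prod_j (1 - z1 * (rkA (underlying1 M) j j)%:C).
Proof.
move=> imex.
have denE i j : (i <= j)%N -> (1%:M - stabA M z1 z2) i j =
    (i == j)%:R - z1 * (rkA (underlying1 M) i j)%:C.
  move=> ij; have stabAE : stabA M z1 z2 i j = z1 * (rkA (underlying1 M) i j)%:C +
      z2 * (rkA (underlying2 M) i j)%:C by rewrite /stabA !mxE.
  rewrite mxE [X in _ + X]mxE mxE stabAE (di_imex_underlying2 _ _ imex ij).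
  by rewrite rmorph0 mulr0 addr0.
rewrite /stab_den det_trig.
  by apply: eq_bigr => j _; rewrite denE // eqxx.
apply/is_trig_mxP => i j ij.
rewrite (denE _ _ (ltnW ij)) (di_imex_underlying1 _ _ imex ij).
by rewrite -val_eqE ltn_eqF // rmorph0 mulr0 subrr.
Qed.

Lemma stab_num_affine (z1 z2 : R[i]) :
  stab_num M z1 z2 = \det (stab_const_term M z2 + z1 *: stab_slope M).
Proof.
rewrite /stab_num; congr (\det _); apply/matrixP => i j.
rewrite /stabA /stabb !(mxE, big_ord1) mul1r 2!rmorphB /=; ring.
Qed.

End Coefficients.

Theorem theorem3p2 (R : realType) (s : nat) (M : nprk R s)
    (S1 S2 : {set 'I_s}) (M1hat : rk R #|S1|) (M2hat : rk R #|S2|)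
    (red1 : reduction (underlying1 M) M1hat)
    (red2 : reduction (underlying2 M) M2hat)
    (mr : multirate S1 S2)
    (imex : di_imex M)
    (cover : S1 :|: S2 = [set: 'I_s])
    (lt12 : (#|S1| < #|S2|)%N)
    (coupling : fully_decoupled M S1 S2 \/ coupled12 M S1 S2)
    (stiff : stiffly_accurate M)
    (diag1 : dirk M1hat /\ nonzero_diagonal M1hat) :
  L_stable_stiff_limit M.
Proof.
have supp1 := underlying1_support _ _ coupling.
have supp2 := underlying2_support _ _ coupling.
have M1E : M1hat = retain_stages (underlying1 M) S1.
  by apply: reduction_supported red1 _ _ => [j|i j _] /supp1[].
have M2E : M2hat = retain_stages (underlying2 M) S2.
  apply: reduction_supported red2 _ _ => [j /supp2[] //|i j iS2 /supp2[_]].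
  exact.
(* A last stage exists because [S2] has more elements than [S1], hence at least one. *)
have s_gt0 : (0 < s)%N.
  by rewrite -[s]card_ord (leq_trans _ (max_card (mem S2))) // (leq_ltn_trans _ lt12).
have lastP : (s.-1 < s)%N by rewrite prednK.
pose p := Ordinal lastP.
have ps : p.+1 = s by rewrite /= prednK.
have [stiff1 stiff2] := stiffly_accurate_underlying p stiff ps.
have A2p i : rkA (underlying2 M) i p = 0%R.
  by rewrite di_imex_underlying2 // -ltnS ps.
have pS1 : p \in S1.
  have : p \in S1 :|: S2 by rewrite cover inE.
  rewrite inE => /orP[//|pS2].
  have [rep [_ _ _ irr]] := red2; rewrite M2E in irr.
  (* By stiff accuracy the weight of [p] is also an entry of the zero column [p] of A2. *)
  by case: (irreducible_stage_used _ _ _ (enum_rank_in pS2 p) irr) => [|i];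
    rewrite mxE enum_rankK_in // stiff2.
pose a j : R[i] := ((rkA (underlying1 M) j j)%:C)%C.
have a_neq0 j : j \in S1 -> a j != 0%R.
  move=> jS1; rewrite fmorph_eq0; have := diag1.2 (enum_rank_in jS1 j).
  by rewrite M1E mxE enum_rankK_in.
move=> z2; split.
  have nz : \forall z1 \near cinfty R, forall j, (1 - z1 * a j)%R != 0%R.
    by apply: filter_forall => j; exact: near_affine_neq0.
  apply: filterS nz => z1 nz; rewrite stab_den_di_imex //.
  by apply/prodf_neq0 => j _; exact: nz.
have RE z1 : stability_function M z1 z2 =
    (\det (stab_const_term M z2 + z1 *: stab_slope M) / \prod_j (1 - z1 * a j))%R.
  by rewrite /stability_function stab_num_affine stab_den_di_imex.
rewrite (funext RE).
apply: (@cvg_det_quotient _ _ _ _ a p) => [i j aj0|j|j aj0].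
- have /supp1[b0 A0] : j \notin S1 by apply: contra_eqN aj0 => /a_neq0.
  by rewrite mxE A0 b0 subrr rmorph0.
- by rewrite mxE stiff1 subrr rmorph0.
(* Row [p] is a unit vector with its 1 in column [p], and [a p] is nonzero since [p] lies in
   [S1]. *)
- rewrite mxE stiff2 subrr rmorph0 mulr0 addr0.
  by case: eqP aj0 => // <- /eqP; rewrite (negbTE (a_neq0 p pS1)).
Qed.
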